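(* Let $G$ be a graph with independence number $2$ and chromatic number $\chi(G)$, and let $\ell$ be an integer with $1 \le \ell \le \chi(G) - 1$. Then $G$ contains an immersion of the complete bipartite graph $K_{\ell, \chi(G) - \ell}$.
   Context: All graphs are finite and loopless (parallel edges are allowed). The independence number of a graph is the maximum size of an independent set of vertices, and $\chi(G)$ is the chromatic number of $G$. $K_{a,b}$ denotes the complete bipartite graph with parts of sizes $a$ and $b$. A graph $G$ contains an immersion of a graph $H$ if there exist an injection $f \colon V(H) \to V(G)$ and a collection of pairwise edge-disjoint paths in $G$, one for each edge of $H$, such that the path corresponding to an edge joining $u$ and $v$ has endvertices $f(u)$ and $f(v)$. (Paths may pass through vertices in the image of $f$.) *)

(* Defs.v *)
From mathcomp Require Import all_boot.

Set Implicit Arguments.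
Unset Strict Implicit.
Unset Printing Implicit Defensive.

(* Finite loopless graphs: edges form a type of their own, so that several
   edges may have the same ends; looplessness is [ends_card]. *)
Record mgraph := MGraph {
  vertex :> finType;
  edge : finType;
  ends : edge -> {set vertex};
  ends_card : forall e : edge, #|ends e| = 2
}.

Section Graph.

Variable G : mgraph.

(* Irreflexive by [ends_card], since [set u; u] has cardinal 1. *)
Definition adj : rel G := [rel u v | [exists e : edge G, ends e == [set u; v]]].

Definition independent (S : {set G}) : bool :=
  [forall u in S, forall v in S, ~~ adj u v].

Definition independence_number : nat :=
  \max_(S : {set G} | independent S) #|S|.

Definition proper_coloring (k : nat) (c : {ffun G -> 'I_k}) : bool :=
  [forall u, forall v, adj u v ==> (c u != c v)].

Definition colorable (k : nat) : bool :=
  [exists c : {ffun G -> 'I_k}, proper_coloring c].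

Lemma colorable_exists : exists k, colorable k.
Proof.
exists #|G|; apply/existsP; exists [ffun u => enum_rank u].
apply/forallP=> u; apply/forallP=> v; apply/implyP=> /existsP[e /eqP uv].
rewrite !ffunE (inj_eq enum_rank_inj); apply/eqP=> u_v.
by have := ends_card e; rewrite uv u_v setUid cards1.
Qed.

Definition chromatic_number : nat := ex_minn colorable_exists.

(* [walk x p]: starting from the vertex x, each step (e, y) in p traverses the
   edge e to reach the vertex y. *)
Fixpoint walk (x : G) (p : seq (edge G * G)) : bool :=
  if p is (e, y) :: p' then (ends e == [set x; y]) && walk y p' else true.

Definition is_path (x : G) (p : seq (edge G * G)) : bool :=
  walk x p && uniq (x :: [seq s.2 | s <- p]).

Definition path_edges (p : seq (edge G * G)) : seq (edge G) :=
  [seq s.1 | s <- p].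

Definition path_ends (x : G) (p : seq (edge G * G)) : {set G} :=
  [set x; last x [seq s.2 | s <- p]].

End Graph.

(* The path of the edge e of H starts at [(P e).1] and has steps [(P e).2].
   Its orientation is irrelevant: only its set of endvertices is prescribed. *)
Definition contains_immersion (G H : mgraph) : Prop :=
  exists (f : H -> G) (P : edge H -> G * seq (edge G * G)),
    [/\ injective f,
        forall e, is_path (P e).1 (P e).2,
        forall e, path_ends (P e).1 (P e).2 = f @: ends e
      & forall e e', e != e' ->
          [disjoint path_edges (P e).2 & path_edges (P e').2]].

Section CompleteBipartite.

Variables a b : nat.

Definition Kab_ends (e : 'I_a * 'I_b) : {set 'I_a + 'I_b} :=
  [set inl e.1; inr e.2].

Lemma Kab_ends_card (e : 'I_a * 'I_b) : #|Kab_ends e| = 2.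
Proof. by rewrite cards2. Qed.

Definition complete_bipartite : mgraph := MGraph Kab_ends_card.

End CompleteBipartite.

(* Main.v *)
Require Import Defs.
From mathcomp Require Import all_boot.
From mathcomp Require Import zify.

(** Let h be the non-adjacency relation of G: independence number 2 makes h
    triangle-free, so that the h-neighbours of a vertex form a clique of G and
    every vertex is adjacent in G to one of u, v whenever h u v.  The edges and
    unmatched vertices of a matching of h are the classes of a proper colouring,
    so a k-chromatic G satisfies 2k <= n + (number of unmatched vertices) for
    every matching of h.  This inequality, localised to a vertex set X
    ([deficient]), is what the induction on the size of X keeps; it yields K_{a,b}
    for all a + b = k ([biclique_of_deficient]).  Let b <= a, and let d(v) count
    the h-neighbours of v in X.

    Reductions.  A vertex h-related to none can be removed and put back as a
    terminal ([add_universal]).  If h x y and x, y have at least b - 1 common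
    neighbours, remove both, take K_{a-1,b} in the rest, and put back x or y as
    a terminal: a terminal v on the other side that is not adjacent to x is
    adjacent to y and is reached along x w y v, with w a common neighbour that
    is not a terminal ([add_far_pair]).  Hence
    d(u) + d(v) >= n - (b - 2) whenever h u v.  A clique with k vertices contains
    K_{a,b}, and vertices whose removal keeps the inequality may be removed.
    Then every vertex is missed by some maximum matching of h; the exchange
    argument of Gallai's lemma ([joint_cover]) splits h into two parts without
    relations between them unless at most one vertex is unmatched, and the degree
    condition rules out such a splitting.  So n >= 2k - 1 ([large_of_critical]).

    Dense case ([biclique_of_edge]).  Fix h x y, with neighbourhoods Nx and Ny.
    Let R be the set of other vertices with an h-neighbour in Ny, and Z the part
    of R with h-neighbours in both.  The vertices outside Nx and R form a clique,
    so Nx and R together have k vertices or more.  The b terminals of one side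
    are taken in Nx, the a terminals of the other side in the rest of Nx and in
    R.  Missing edges run from i in Z to j in Ux, the h-neighbours of Z in Nx.
    They are replaced by paths i, s j, t i, j with t i in Uy, the h-neighbours
    of Z in Ny, and s j in the rest of Ny.  This works because Ux and Uy are
    completely joined in G ([Ux_Uy]): an h-relation between them would create a
    configuration of eight vertices in which no four are pairwise h-unrelated,
    which bounds their degree sum by 3n, against the degree condition.  As Ux and Uy form a clique together, they have
    fewer than k vertices, which leaves enough of Ny for the vertices s j. *)

Set Implicit Arguments.
Unset Strict Implicit.
Unset Printing Implicit Defensive.

(** * Systems of edge-disjoint paths *)

Lemma set2_eq (T : finType) (a b c d : T) :
  [set a; b] = [set c; d] -> a = c /\ b = d \/ a = d /\ b = c.
Proof.
move=> eq_s.
have /set2P a_in : a \in [set c; d] by rewrite -eq_s set21.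
have /set2P b_in : b \in [set c; d] by rewrite -eq_s set22.
have /set2P c_in : c \in [set a; b] by rewrite eq_s set21.
have /set2P d_in : d \in [set a; b] by rewrite eq_s set22.
by intuition congruence.
Qed.

Section Linkage.

Variables (T : finType) (e : rel T).
Implicit Types (X A B E : {set T}) (P : T -> T -> T * seq T) (p : seq T).
Implicit Types (x y u v w i j : T).

Definition path_pairs x p : seq {set T} := pairmap (fun u v => [set u; v]) x p.

(** The path for i and j may start at either end, which makes the notion
    symmetric in A and B.  The last clause is edge-disjointness: an unordered
    pair of consecutive vertices determines the terminals of its path. *)
Definition linkage X A B P : Prop :=
  [/\ A :|: B \subset X, [disjoint A & B],
      {in A & B, forall i j, let: (x, p) := P i j in
         [/\ path e x p, uniq (x :: p), [set x; last x p] = [set i; j]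
           & {subset x :: p <= X}]}
    & forall E i j i' j', i \in A -> j \in B -> i' \in A -> j' \in B ->
        E \in path_pairs (P i j).1 (P i j).2 ->
        E \in path_pairs (P i' j').1 (P i' j').2 -> i = i' /\ j = j'].

Definition has_biclique X a b : Prop :=
  exists A B P, [/\ linkage X A B P, #|A| = a & #|B| = b].

Lemma has_biclique_sym X a b : has_biclique X a b -> has_biclique X b a.
Proof.
move=> [A [B [P [[sX dAB path_P edge_P] cA cB]]]].
exists B, A, (fun j i => P i j); split=> //; split.
- by rewrite setUC.
- by rewrite disjoint_sym.
- move=> j i Bj Ai; move: (path_P i j Ai Bj); case: (P i j) => x p [? ? -> ?].
  by split; rewrite // setUC.
- move=> E j i j' i' Bj Ai Bj' Ai' E1 E2.
  by have [] := edge_P E i j i' j' Ai Bj Ai' Bj' E1 E2.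
Qed.

Lemma path_pairs_sub X x p E :
  {subset x :: p <= X} -> E \in path_pairs x p -> E \subset X.
Proof.
elim: p x => //= y p IHp x sX; rewrite inE => /orP[/eqP->|].
  by apply/subsetP=> z /set2P[]->; apply: sX; rewrite !inE eqxx ?orbT.
by apply: IHp => z zp; apply: sX; rewrite inE zp orbT.
Qed.

(** The old paths use only pairs inside X', so new paths from x that avoid such
    pairs can only conflict with one another. *)
Lemma linkage_add X X' A B P x (Q : T -> seq T) :
  X' \subset X -> x \in X -> x \notin X' -> linkage X' A B P ->
  {in B, forall v, [/\ path e x (Q v), uniq (x :: Q v), last x (Q v) = v
                     & {subset Q v <= X}]} ->
  {in B, forall v E, E \in path_pairs x (Q v) -> ~~ (E \subset X')} ->
  {in B &, forall v v' E, E \in path_pairs x (Q v) ->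
             E \in path_pairs x (Q v') -> v = v'} ->
  linkage X (x |: A) B (fun i j => if i == x then (x, Q j) else P i j).
Proof.
move=> sX Xx nX'x [sAB dAB path_P edge_P] path_Q new_Q edge_Q.
have sA := subset_trans (subsetUl A B) sAB.
have sB := subset_trans (subsetUr A B) sAB.
have nx z : z \in X' -> (z == x) = false.
  by apply: contraTF => /eqP->.
have old i j : i \in x |: A -> i != x -> j \in B -> i \in A /\
    {in path_pairs (P i j).1 (P i j).2, forall E, E \subset X'}.
  move=> /setU1P[->|Ai]; first by rewrite eqxx.
  move=> _ Bj; split=> // E; have := path_P i j Ai Bj.
  by case: (P i j) => y p [_ _ _ sp]; apply: path_pairs_sub.
split.
- by rewrite -setUA subUset sub1set Xx (subset_trans sAB sX).
- rewrite -setI_eq0 setIUl setU_eq0 !setI_eq0 dAB andbT disjoints1.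
  by apply: contra nX'x; apply/subsetP.
- move=> i j xAi Bj /=; case: eqP => [->|/eqP ix].
    have [? ? -> sQ] := path_Q j Bj; split=> // z.
    by rewrite inE => /orP[/eqP->|/sQ].
  have [Ai _] := old i j xAi ix Bj.
  have := path_P i j Ai Bj; case: (P i j) => y p [? ? ? sp]; split=> // z /sp.
  exact: subsetP.
- move=> E i j i' j' xAi Bj xAi' Bj' /=.
  case: eqP => [->|/eqP ix] /=; case: eqP => [->|/eqP ix'] /= E1 E2.
  + by split=> //; apply: edge_Q E1 E2.
  + have [_ s] := old i' j' xAi' ix' Bj'.
    by have := new_Q j Bj E E1; rewrite s.
  + have [_ s] := old i j xAi ix Bj.
    by have := new_Q j' Bj' E E2; rewrite s.
  + have [Ai _] := old i j xAi ix Bj; have [Ai' _] := old i' j' xAi' ix' Bj'.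
    exact: edge_P E1 E2.
Qed.

Lemma has_biclique_direct X A B :
  A :|: B \subset X -> [disjoint A & B] -> irreflexive e ->
  {in A & B, forall i j, e i j} -> has_biclique X #|A| #|B|.
Proof.
move=> sX dAB e_irr eAB; exists A, B, (fun i j => (i, [:: j])).
have nAB i j : i \in A -> j \in B -> i != j.
  by move=> Ai Bj; apply: contraTneq (eAB i j Ai Bj) => ->; rewrite e_irr.
split=> //; split=> //.
- move=> i j Ai Bj /=; rewrite andbT inE andbT; split=> //; first exact: eAB.
    exact: nAB.
  by move=> z; rewrite !inE => zij; apply: (subsetP sX); rewrite inE;
    case/orP: zij => /eqP->; rewrite ?Ai ?Bj ?orbT.
- move=> E i j i' j' Ai Bj Ai' Bj'; rewrite /= !inE => /eqP-> /eqP/set2_eq[//|].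
  by move=> [ij' _]; have := nAB i j' Ai Bj'; rewrite ij' eqxx.
Qed.

End Linkage.

Lemma inj_into (T : finType) (S S' : {set T}) :
  #|S| <= #|S'| -> exists f : T -> T,
    {in S, forall z, f z \in S'} /\ {in S &, injective f}.
Proof.
move=> leSS'; exists (fun z => nth z (enum S') (index z (enum S))).
have lt z : z \in S -> index z (enum S) < size (enum S').
  by move=> Sz; rewrite -cardE (leq_trans _ leSS') // cardE index_mem mem_enum.
split=> [z Sz|z z' Sz Sz']; first by rewrite -mem_enum mem_nth ?lt.
rewrite (set_nth_default z' z) ?lt // => /eqP.
rewrite nth_uniq ?lt ?enum_uniq // => /eqP eq_i.
by rewrite -(nth_index z (s := enum S) (x := z)) ?mem_enum // eq_i nth_index ?mem_enum.
Qed.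

(** * Putting removed vertices back as terminals *)

Section NonAdjacency.

Variables (T : finType) (h : rel T).
Hypotheses (h_sym : symmetric h) (h_irr : irreflexive h).
Hypothesis h_tri : forall u v w, h u v -> h v w -> ~~ h u w.
Implicit Types (X A B E : {set T}) (x y u v w i j : T).

Definition adjacent u v := (u != v) && ~~ h u v.

Definition nb X v : {set T} := [set u in X | h v u].

Lemma adjacent_irr : irreflexive adjacent.
Proof. by move=> u; rewrite /adjacent eqxx. Qed.

Lemma h_neq u v : h u v -> u != v.
Proof. by apply: contraTneq => ->; rewrite h_irr. Qed.

(** This is how triangle-freeness enters the counting arguments. *)
Lemma nb_disjoint X u v : h u v -> [disjoint nb X u & nb X v].
Proof.
move=> uv; rewrite -setI_eq0; apply/eqP/setP=> z; rewrite !inE.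
apply/negP=> /andP[/andP[_ uz] /andP[_ vz]].
by move: (h_tri uv vz); rewrite uz.
Qed.

Lemma add_universal X x a b :
  x \in X -> {in X, forall u, ~~ h x u} ->
  has_biclique adjacent (X :\ x) a b -> has_biclique adjacent X a.+1 b.
Proof.
move=> Xx hx [A [B [P [lP cA cB]]]]; case: (lP) => sAB _ _ _.
have sX : X :\ x \subset X by apply: subD1set.
have nx : x \notin X :\ x by rewrite setD11.
have inB v : v \in B -> v != x /\ v \in X.
  by move=> Bv; apply/setD1P; apply: (subsetP sAB); rewrite inE Bv orbT.
exists (x |: A), B, (fun i j => if i == x then (x, [:: j]) else P i j); split=> //.
- apply: (linkage_add (Q := fun j => [:: j]) sX Xx nx lP) => [v|v|v v'] Bv.
  + have [vx Xv] := inB v Bv; rewrite /= /adjacent !inE eq_sym vx hx //.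
    by split=> // z; rewrite inE => /eqP->.
  + move=> E; rewrite inE => /eqP->.
    by apply: contra nx => /subsetP; apply; rewrite set21.
  + move=> Bv' E; rewrite !inE => /eqP-> /eqP/set2_eq[[]//|[_]].
    by case: (inB v Bv) => /eqP.
- rewrite cardsU1 cA; case: (boolP (x \in A)) => // Ax.
  by move: nx; rewrite (subsetP sAB) // inE Ax.
Qed.

(** A terminal v with h x v is adjacent to y, since h x y and h is
    triangle-free, and so is reached along x, om v, y, v.  The vertex om v avoids
    B because the edge from x to a vertex of B adjacent to x already serves as
    the path to that vertex. *)
Lemma add_far_end X x y A B P :
  x \in X -> y \in X -> h x y -> linkage adjacent (X :\: [set x; y]) A B P ->
  #|B :&: nb X x| <= #|(X :\: nb X x :\: nb X y) :\: B| ->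
  has_biclique adjacent X #|A|.+1 #|B|.
Proof.
move=> Xx Xy xy lP /inj_into[om [om_in om_inj]]; case: (lP) => sAB _ _ _.
have yx : h y x by rewrite h_sym.
have neq_xy := h_neq xy.
pose Q v := if h x v then [:: om v; y; v] else [:: v].
have sX : X :\: [set x; y] \subset X by apply: subsetDl.
have nx : x \notin X :\: [set x; y] by rewrite !inE eqxx.
have ny : y \notin X :\: [set x; y] by rewrite !inE eqxx orbT.
have inB v : v \in B -> [/\ v != x, v != y & v \in X].
  move=> Bv; have: v \in X :\: [set x; y].
    by apply: (subsetP sAB); rewrite inE Bv orbT.
  by rewrite !inE negb_or => /andP[/andP[]].
have omP v : v \in B -> h x v ->
    [/\ om v \in X, om v \notin B, ~~ h x (om v), ~~ h y (om v)
      & [&& om v != x, om v != y & ~~ h y v]].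
  move=> Bv xv; have [vx vy Xv] := inB v Bv.
  have: om v \in X :\: nb X x :\: nb X y :\: B.
    by apply: om_in; rewrite !inE Bv Xv xv.
  rewrite !inE => /and4P[nB + + Xo]; rewrite Xo /= => nhy nhx; split=> //.
  rewrite (h_tri yx xv) andbT.
  by apply/andP; split; [apply: contraNneq nhy|apply: contraNneq nhx] => ->.
have nsub z E : z \in E -> z \notin X :\: [set x; y] -> ~~ (E \subset X :\: [set x; y]).
  by move=> Ez; apply: contra => /subsetP; apply.
exists (x |: A), B, (fun i j => if i == x then (x, Q j) else P i j).
split=> //.
- apply: (linkage_add (Q := Q) sX Xx nx lP) => [v|v|v v'] Bv.
  + rewrite /Q; have [vx vy Xv] := inB v Bv; case: ifP => xv; last first.
      have xv' : x != v by rewrite eq_sym.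
      split=> //=; rewrite /adjacent ?inE ?xv ?xv' // => z.
      by rewrite inE => /eqP->.
    have [Xo oB xo yo /and3P[ox oy yv]] := omP v Bv xv.
    have ov : om v != v by apply: contraNneq oB => ->.
    split=> //=; rewrite /adjacent.
    * by rewrite xo eq_sym ox oy h_sym yo eq_sym vy yv.
    * by rewrite !inE !negb_or neq_xy eq_sym ox eq_sym vx oy ov eq_sym vy.
    * by move=> z; rewrite !inE => /or3P[]/eqP->.
  + rewrite /Q => E; case: ifP => _; rewrite !inE; last first.
      by move=> /eqP->; apply: nsub nx; rewrite set21.
    case/or3P=> /eqP->; [apply: nsub nx|apply: nsub ny|apply: nsub ny];
      by rewrite ?set21 ?set22.
  + move=> Bv' E; rewrite /Q.
    have [/eqP vx /eqP vy Xv] := inB v Bv.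
    have [/eqP v'x /eqP v'y Xv'] := inB v' Bv'.
    have ov w u : w \in B -> u \in B -> h x w -> om w <> u.
      by move=> Bw Bu xw ou; have [_] := omP w Bw xw; rewrite ou Bu.
    have oxy w : w \in B -> h x w -> om w <> x /\ om w <> y.
      by move=> Bw xw; have [_ _ _ _ /and3P[/eqP ? /eqP ?]] := omP w Bw xw.
    move/eqP: neq_xy => neq_xy.
    case: ifP => xv; case: ifP => xv'; rewrite !inE.
    * have := ov v v' Bv Bv' xv; have := ov v' v Bv' Bv xv'.
      have := ov v v Bv Bv xv; have := ov v' v' Bv' Bv' xv'.
      have [? ?] := oxy v Bv xv; have [? ?] := oxy v' Bv' xv'.
      have oo : om v = om v' -> v = v'.
        by apply: om_inj; rewrite !inE ?Bv ?Bv' ?Xv ?Xv'.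
      move=> ? ? ? ?.
      by case/or3P=> /eqP-> /or3P[]/eqP/set2_eq[]; intuition congruence.
    * have := ov v v' Bv Bv' xv; have [? ?] := oxy v Bv xv.
      by move=> ?; case/or3P=> /eqP-> /eqP/set2_eq[]; intuition congruence.
    * have := ov v' v Bv' Bv xv'; have [? ?] := oxy v' Bv' xv'.
      by move=> ? /eqP-> /or3P[]/eqP/set2_eq[]; intuition congruence.
    * by move=> /eqP-> /eqP/set2_eq[]; intuition congruence.
- rewrite cardsU1; case: (boolP (x \in A)) => // Ax.
  by move: nx; rewrite (subsetP sAB) // inE Ax.
Qed.

(** Put back x or y, whichever is non-adjacent to fewer vertices of B.  If that
    number m is positive, the vertices of B non-adjacent to x or to y number at
    least 2m >= m + 1, so at most b - 1 - m common neighbours of x and y lie in B,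
    and m remain outside B. *)
Lemma add_far_pair X x y a b :
  x \in X -> y \in X -> h x y -> b <= #|X :\: nb X x :\: nb X y|.+1 ->
  has_biclique adjacent (X :\: [set x; y]) a b ->
  has_biclique adjacent X a.+1 b.
Proof.
move=> Xx Xy xy le_b [A [B [P [lP cA cB]]]]; subst a b.
have sB : B \subset X.
  case: lP => sAB _ _ _; apply: subset_trans (subset_trans (subsetUr A B) sAB) _.
  exact: subsetDl.
set C := X :\: nb X x :\: nb X y in le_b.
have cardB : #|B| = #|B :&: nb X x| + #|B :&: nb X y| + #|C :&: B|.
  rewrite -(cardsID (nb X x) B) -addnA; congr (_ + _).
  rewrite -(cardsID (nb X y) (B :\: nb X x)); congr (_ + _);
    apply: eq_card => z; rewrite !inE.
    case Bz: (z \in B); rewrite ?andbF //=; case Xz: (z \in X) => //=.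
    case yz: (h y z); rewrite ?andbF ?andbT //=.
    by rewrite (negbTE (h_tri xy yz)).
  case Bz: (z \in B); rewrite ?andbF ?andbT //=.
  by rewrite (subsetP sB z Bz) /= andbT.
have := cardsID B C.
have [lexy|ltyx] := leqP #|B :&: nb X x| #|B :&: nb X y| => cardC.
  apply: (add_far_end Xx Xy xy lP); rewrite -/C; lia.
have yx : h y x by rewrite h_sym.
have lP' : linkage adjacent (X :\: [set y; x]) A B P by rewrite setUC.
apply: (add_far_end Xy Xx yx lP'); rewrite (setDDl X) (setUC (nb X y)) -(setDDl X) -/C; lia.
Qed.

End NonAdjacency.

(** * Matchings and Gallai's lemma *)

(** A matching is encoded as the involution that exchanges the ends of its edges
    and fixes every unmatched vertex. *)
Section Matchings.

Variables (T : finType) (h : rel T).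
Hypotheses (h_sym : symmetric h) (h_irr : irreflexive h).
Implicit Types (X : {set T}) (f M N : {ffun T -> T}) (r s t u v w z : T).

Definition matching X f : bool :=
  [forall v, (f (f v) == v) && ((f v != v) ==> (v \in X) && h v (f v))].

Definition unmatched X f : {set T} := [set v in X | f v == v].

(** One vertex from each matching edge, and all unmatched vertices. *)
Definition leader f : {set T} := [set v | enum_rank v <= enum_rank (f v)].

Lemma matchingP X f :
  reflect (involutive f /\ forall v, f v != v -> v \in X /\ h v (f v))
          (matching X f).
Proof.
apply: (iffP forallP) => [fP|[fK fX] v].
  split=> [v|v fv]; first by case/andP: (fP v) => /eqP.
  by have /andP[_] := fP v; rewrite fv => /andP[].
by rewrite fK eqxx /=; apply/implyP => /fX[-> ->].
Qed.

Lemma matching_sub X X' f : X' \subset X -> matching X' f -> matching X f.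
Proof.
move=> sX /matchingP[fK fX]; apply/matchingP; split=> // v /fX[X'v ->].
by rewrite (subsetP sX).
Qed.

Lemma matching_in X f v : matching X f -> v \in X -> f v \in X.
Proof.
move=> /matchingP[fK fX] Xv; case: (eqVneq (f v) v) => [->//|fv].
by have [] := fX (f v); rewrite // fK eq_sym.
Qed.

(** Besides relating matchings to colour classes, this shows that the numbers of
    vertices and of unmatched vertices have the same parity. *)
Lemma card_leader X f :
  matching X f -> (#|X :&: leader f|).*2 = #|X| + #|unmatched X f|.
Proof.
move=> fM; have /matchingP[fK fX] := fM.
have fI := inv_inj fK.
have eq_r u v : (enum_rank u == enum_rank v :> nat) = (u == v).
  by rewrite -(inj_eq enum_rank_inj).
have imf : X :\: leader f = f @: (X :&: leader f :\: unmatched X f).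
  apply/setP=> z; rewrite -{2}[z]fK mem_imset // !inE fK.
  have -> : (f z \in X) = (z \in X).
    by apply/idP/idP => [/(matching_in fM)|/(matching_in fM)//]; rewrite fK.
  case: (z \in X); rewrite ?andbF ?andbT //= -eq_r.
  by rewrite -ltnNge ltn_neqAle eq_sym.
have := cardsID (leader f) X; have := cardsID (unmatched X f) (X :&: leader f).
rewrite imf card_imset //.
have -> : X :&: leader f :&: unmatched X f = unmatched X f; last by lia.
apply/setP=> z; rewrite !inE; case: (z \in X) => //=.
by case: eqP => [->|_]; rewrite ?leqnn ?andbF.
Qed.

Definition add_edge f u v : {ffun T -> T} :=
  [ffun z => if z == u then v else if z == v then u else f z].

Definition remove_edge f w : {ffun T -> T} :=
  [ffun z => if (z == w) || (z == f w) then z else f z].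

Lemma matching_add X f u v :
  matching X f -> u \in X -> v \in X -> h u v -> f u = u -> f v = v ->
  matching X (add_edge f u v).
Proof.
move=> /matchingP[fK fX] Xu Xv uv fu fv; apply/matchingP.
have neq_f z : z != u -> z != v -> (f z == u) = false /\ (f z == v) = false.
  move=> zu zv; split; apply/negP => /eqP/(congr1 f); rewrite fK.
    by rewrite fu => /eqP; rewrite (negbTE zu).
  by rewrite fv => /eqP; rewrite (negbTE zv).
split=> z; rewrite !ffunE.
  case: (eqVneq z u) => [->|zu].
    by rewrite eqxx; case: eqP.
  case: (eqVneq z v) => [->|zv]; first by rewrite eqxx.
  by have [-> ->] := neq_f z zu zv.
case: (eqVneq z u) => [->//|zu].
case: (eqVneq z v) => [->|zv]; first by rewrite h_sym.
exact: fX.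
Qed.

Lemma unmatched_add X f u v :
  u \in X -> v \in X -> u != v -> f u = u -> f v = v ->
  unmatched X f = u |: (v |: unmatched X (add_edge f u v)).
Proof.
move=> Xu Xv uv fu fv; apply/setP=> z; rewrite !inE !ffunE.
case: (eqVneq z u) => [->|zu]; first by rewrite Xu fu eqxx.
by case: (eqVneq z v) => [->|zv]; first by rewrite Xv fv eqxx.
Qed.

Lemma card_unmatched_add X f u v :
  u \in X -> v \in X -> u != v -> f u = u -> f v = v ->
  #|unmatched X f| = #|unmatched X (add_edge f u v)|.+2.
Proof.
move=> Xu Xv uv fu fv; have vu : v != u by rewrite eq_sym.
rewrite (unmatched_add Xu Xv uv fu fv) !cardsU1 !inE !ffunE !eqxx.
by rewrite (negbTE uv) (negbTE vu) /= (negbTE uv) !andbF.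
Qed.

Lemma matching_remove X f w : matching X f -> matching X (remove_edge f w).
Proof.
move=> /matchingP[fK fX]; apply/matchingP.
have fI := inv_inj fK.
split=> z; rewrite !ffunE; case cz: ((z == w) || (z == f w)).
- by rewrite cz.
- have -> : (f z == w) || (f z == f w) = false; last exact: fK.
  by rewrite -{1}[w]fK !(inj_eq fI) orbC.
- by rewrite eqxx.
- exact: fX.
Qed.

Lemma unmatched_remove X f w :
  matching X f -> w \in X -> unmatched X (remove_edge f w) = w |: (f w |: unmatched X f).
Proof.
move=> fM Xw; have /matchingP[fK _] := fM.
apply/setP=> z; rewrite !inE !ffunE.
case: (eqVneq z w) => [->|zw] /=; first by rewrite Xw eqxx.
by case: (eqVneq z (f w)) => [->|//]; rewrite (matching_in fM) ?eqxx.
Qed.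

Lemma card_unmatched_remove X f w :
  matching X f -> w \in X -> f w != w ->
  #|unmatched X (remove_edge f w)| = #|unmatched X f|.+2.
Proof.
move=> fM Xw fw; have /matchingP[fK _] := fM.
have wf : w != f w by rewrite eq_sym.
by rewrite unmatched_remove // !cardsU1 !inE fK (negbTE fw) (negbTE wf) !andbF.
Qed.

(** For d the least number of unmatched vertices, s and t are joint when some
    maximum matching misses both. *)
Definition joint X d s t : bool :=
  [exists f : {ffun T -> T}, [&& matching X f, #|unmatched X f| == d,
     f s == s, f t == t & s != t]].

Lemma jointP X d s t :
  reflect (exists f, [/\ matching X f, #|unmatched X f| = d, f s = s, f t = t
                       & s != t]) (joint X d s t).
Proof.
apply: (iffP existsP) => -[f fP]; exists f.
  by case/and5P: fP => ? /eqP ? /eqP ? /eqP ? ?.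
by case: fP => -> -> -> -> ->; rewrite !eqxx.
Qed.

Lemma joint_sym X d s t : joint X d s t = joint X d t s.
Proof.
by apply/jointP/jointP => -[f [? ? ? ? ?]]; exists f; split; rewrite // eq_sym.
Qed.

Section MinimumDeficiency.

Variables (X : {set T}) (d : nat).
Hypothesis d_min : forall f, matching X f -> d <= #|unmatched X f|.

Lemma joint_h s t : s \in X -> t \in X -> h s t -> ~~ joint X d s t.
Proof.
move=> Xs Xt st; apply/negP => /jointP[f [fM fd fs ft neq_st]].
have := d_min (matching_add fM Xs Xt st fs ft).
by rewrite -fd (card_unmatched_add Xs Xt neq_st fs ft) => /ltnW; rewrite ltnn.
Qed.

(** The key to Gallai's lemma.  Let M be a maximum matching missing s and t, and
    N one missing r that agrees with M as much as possible.  If N covers s and t,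
    then some w other than r is missed by N but covered by M; replacing in N the
    edge at M w by the edge from w to M w keeps r missed and increases the
    agreement. *)
Lemma joint_cover r s t :
  (exists f, [/\ matching X f, #|unmatched X f| = d & f r = r]) ->
  r \in X -> s \in X -> t \in X ->
  joint X d s t -> joint X d s r || joint X d t r.
Proof.
move=> [N0 [N0M N0d N0r]] Xr Xs Xt /jointP[M [MM Md Ms Mt st]].
apply/norP => -[nsr ntr].
have sr : s != r.
  apply: contraNneq ntr => <-; apply/jointP; exists M; split=> //.
  by rewrite eq_sym.
have tr : t != r by apply: contraNneq nsr => <-; apply/jointP; exists M.
(* N maximizes the agreement with M among maximum matchings missing r. *)
pose fixing f := [&& matching X f, #|unmatched X f| == d & f r == r].
have fixN0 : fixing N0 by rewrite /fixing N0M N0d N0r !eqxx.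
case: (arg_maxnP (fun N : {ffun T -> T} => #|[set v | N v == M v]|) fixN0).
move=> N /and3P[NM /eqP Nd /eqP Nr] Nmax.
have nfix z : z != r -> ~~ joint X d z r -> N z != z.
  by move=> zr; apply: contra => /eqP Nz; apply/jointP; exists N.
(* N and M miss d vertices each; M misses s and t, which N covers. *)
have [w] : exists w, w \in unmatched X N :\ r :\: unmatched X M.
  apply/set0Pn; rewrite setD_eq0; apply/negP => sNM.
  have sub : unmatched X N :\ r \subset unmatched X M :\ s :\ t.
    apply/subsetP => z zN; move: zN (subsetP sNM z zN).
    rewrite !inE => /and3P[_ _ /eqP Nz] /andP[-> ->]; rewrite !andbT.
    have [/eqP Ns /eqP Nt] := (nfix s sr nsr, nfix t tr ntr).
    by apply/andP; split; apply/eqP => zz; subst z.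
  have cN : d = #|unmatched X N :\ r|.+1.
    by rewrite -Nd (cardsD1 r (unmatched X N)) inE Xr Nr eqxx.
  have cM : d = #|unmatched X M :\ s :\ t|.+2.
    rewrite -Md (cardsD1 s (unmatched X M)) (cardsD1 t (_ :\ s)) !inE.
    by rewrite Xs Ms Xt Mt !eqxx eq_sym st.
  by move: (subset_leq_card sub); rewrite -ltnS -cN cM ltnn.
rewrite !inE => /and3P[Mw wr /andP[Xw /eqP Nw]].
move: Mw; rewrite Xw /= => Mw.
have /matchingP[NK NX] := NM; have /matchingP[MK MX] := MM.
have [_ hw] := MX w Mw; set w' := M w in Mw hw.
have Xw' : w' \in X by apply: matching_in.
have ww' : w != w' by rewrite eq_sym.
have Nw' : N w' != w'.
  apply/eqP => Nw'; have := d_min (matching_add NM Xw Xw' hw Nw Nw').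
  by rewrite -Nd (card_unmatched_add Xw Xw' ww' Nw Nw') => /ltnW; rewrite ltnn.
have N'M := matching_remove w' NM.
have fix_w : remove_edge N w' w = w by rewrite ffunE Nw; case: ifP.
have fix_w' : remove_edge N w' w' = w' by rewrite ffunE eqxx.
pose N' := add_edge (remove_edge N w') w w'.
have N'P : fixing N'.
  apply/and3P; split; first exact: matching_add.
    have := card_unmatched_add Xw Xw' ww' fix_w fix_w'.
    by rewrite card_unmatched_remove // Nd => -[<-].
  have rw' : r != w' by apply: contraNneq Nw' => <-; rewrite Nr.
  by rewrite !ffunE [r == w]eq_sym (negbTE wr) (negbTE rw') Nr if_same.
have /= := Nmax N' N'P; rewrite leqNgt => /negP; apply.
have NMw : N w' != w by apply: contraNneq ww' => Nw'w; rewrite -{1}Nw -Nw'w NK.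
apply: proper_card; apply/properP; split; last first.
  by exists w; rewrite inE ?ffunE ?eqxx // Nw.
apply/subsetP => z; rewrite !inE => /eqP NMz; rewrite !ffunE.
case: (eqVneq z w) => [->//|zw]; case: (eqVneq z w') => [zw'|zw'].
  by move: NMz NMw; rewrite zw' [M w']MK => ->; rewrite eqxx.
case: (eqVneq z (N w')) => [zN|_] /=; last by rewrite NMz.
by move: NMz zw; rewrite {1}zN NK => /(can_inj MK) ->; rewrite eqxx.
Qed.

End MinimumDeficiency.

End Matchings.

(** * Replacing missing edges by detours *)

Lemma disjointDl (T : finType) (A B S : {set T}) :
  S \subset B -> [disjoint A :\: B & S].
Proof.
move=> sSB; rewrite -setI_eq0; apply/eqP/setP => z; rewrite !inE.
by apply/negP => /andP[/andP[/negP nB _] /(subsetP sSB)].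
Qed.

Lemma subset_of_card (T : finType) (S : {set T}) m :
  m <= #|S| -> exists2 S' : {set T}, S' \subset S & #|S'| = m.
Proof.
move=> le_m; exists [set z in take m (enum S)].
  by apply/subsetP => z; rewrite inE => /mem_take; rewrite mem_enum.
rewrite cardsE (card_uniqP _) ?take_uniq ?enum_uniq //.
by rewrite size_takel // -cardE.
Qed.

(** Edge-disjointness comes from the shape i, s j, t i, j of the detours: each
    pair of consecutive vertices shows one of i, t i and one of j, s j, and s and
    t are injective. *)
Lemma linkage_detour (T : finType) (e : rel T) (X A B Z U S S' : {set T}) (s t : T -> T) :
  A :|: B \subset X -> S :|: S' \subset X -> [disjoint A & B] -> [disjoint S & S'] ->
  [disjoint A :|: B & S :|: S'] ->
  {in B :&: U, forall j, s j \in S} -> {in B :&: U &, injective s} ->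
  {in A :&: Z, forall i, t i \in S'} -> {in A :&: Z &, injective t} ->
  {in A & B, forall i j, if (i \in Z) && (j \in U)
     then [/\ e i (s j), e (s j) (t i) & e (t i) j] else e i j} ->
  linkage e X A B (fun i j =>
    (i, if (i \in Z) && (j \in U) then [:: s j; t i; j] else [:: j])).
Proof.
move=> sAB sSS dAB dSS dABS sS s_inj tS t_inj eP.
have AX i : i \in A -> i \in X.
  by move=> Ai; apply: (subsetP sAB); rewrite inE Ai.
have BX j : j \in B -> j \in X.
  by move=> Bj; apply: (subsetP sAB); rewrite inE Bj orbT.
have nAB i j : i \in A -> j \in B -> i <> j.
  by move=> Ai Bj ij; have := disjointFr dAB Ai; rewrite ij Bj.
have nSS u v : u \in S -> v \in S' -> u <> v.
  by move=> Su Sv uv; have := disjointFr dSS Su; rewrite uv Sv.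
have nAS i u : i \in A -> u \in S :|: S' -> i <> u.
  move=> Ai Su iu; have := disjointFl dABS Su.
  by rewrite -iu !inE Ai.
have nBS j u : j \in B -> u \in S :|: S' -> j <> u.
  move=> Bj Su ju; have := disjointFl dABS Su.
  by rewrite -ju !inE Bj orbT.
have sP j : j \in B -> j \in U -> s j \in S by move=> Bj Uj; apply: sS; rewrite inE Bj.
have tP i : i \in A -> i \in Z -> t i \in S' by move=> Ai Zi; apply: tS; rewrite inE Ai.
have sU u : u \in S -> u \in S :|: S' by move=> Su; rewrite inE Su.
have sU' u : u \in S' -> u \in S :|: S' by move=> Su; rewrite inE Su orbT.
split=> //.
- move=> i j Ai Bj /=; have := eP i j Ai Bj.
  have ij : i != j by apply/eqP; apply: nAB.
  case: ifP => [/andP[Zi Uj] [e1 e2 e3]|_ eij].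
    have [Ss St] := (sP j Bj Uj, tP i Ai Zi).
    have := nAS _ _ Ai (sU _ Ss); have := nAS _ _ Ai (sU' _ St).
    have := nBS _ _ Bj (sU _ Ss); have := nBS _ _ Bj (sU' _ St).
    have := nSS _ _ Ss St.
    move=> /eqP n1 /eqP n2 /eqP n3 /eqP n4 /eqP n5.
    split=> //=; first by rewrite e1 e2 e3.
      by rewrite !inE !negb_or n1 n4 n5 ij [s j == j]eq_sym n3 eq_sym n2.
    move=> z; rewrite !inE => /or4P[] /eqP->; [exact: AX| | |exact: BX];
      by apply: (subsetP sSS); auto.
  split=> //=; rewrite ?eij ?inE ?ij // => z.
  by rewrite !inE => /orP[] /eqP->; auto.
- move=> E i j i' j' Ai Bj Ai' Bj' /=.
  have := nAB i j' Ai Bj'; have := nAB i' j Ai' Bj.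
  case: ifP => [/andP[Zi Uj]|_]; case: ifP => [/andP[Zi' Uj']|_]; rewrite !inE.
  + have [Ss St] := (sP j Bj Uj, tP i Ai Zi).
    have [Ss' St'] := (sP j' Bj' Uj', tP i' Ai' Zi').
    have := nAS _ _ Ai (sU _ Ss'); have := nAS _ _ Ai (sU' _ St').
    have := nBS _ _ Bj (sU _ Ss'); have := nBS _ _ Bj (sU' _ St').
    have := nAS _ _ Ai' (sU _ Ss); have := nAS _ _ Ai' (sU' _ St).
    have := nBS _ _ Bj' (sU _ Ss); have := nBS _ _ Bj' (sU' _ St).
    have := nSS _ _ Ss St; have := nSS _ _ Ss St'.
    have := nSS _ _ Ss' St; have := nSS _ _ Ss' St'.
    have ss : s j = s j' -> j = j' by apply: s_inj; rewrite inE ?Bj ?Bj'.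
    have tt : t i = t i' -> i = i' by apply: t_inj; rewrite inE ?Ai ?Ai'.
    do 14![move=> ?].
    by case/or3P=> /eqP-> /or3P[]/eqP/set2_eq[]; intuition congruence.
  + have [Ss St] := (sP j Bj Uj, tP i Ai Zi).
    have := nAS _ _ Ai' (sU _ Ss); have := nAS _ _ Ai' (sU' _ St).
    have := nBS _ _ Bj' (sU _ Ss); have := nBS _ _ Bj' (sU' _ St).
    do 6![move=> ?].
    by case/or3P=> /eqP-> /eqP/set2_eq[]; intuition congruence.
  + have [Ss' St'] := (sP j' Bj' Uj', tP i' Ai' Zi').
    have := nAS _ _ Ai (sU _ Ss'); have := nAS _ _ Ai (sU' _ St').
    have := nBS _ _ Bj (sU _ Ss'); have := nBS _ _ Bj (sU' _ St').
    do 6![move=> ?].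
    by move=> /eqP-> /or3P[]/eqP/set2_eq[]; intuition congruence.
  + by move=> ? ? /eqP-> /eqP/set2_eq[]; intuition congruence.
Qed.

(** * Dense non-adjacency *)

(** In the application g = b - 2: any x, y with h x y have at most g common
    neighbours in X. *)
Section Dense.

Variables (T : finType) (h : rel T).
Hypotheses (h_sym : symmetric h) (h_irr : irreflexive h).
Hypothesis h_tri : forall u v w, h u v -> h v w -> ~~ h u w.
Variables (X : {set T}) (a b g : nat).
Let k := a + b.
Hypothesis dense : {in X &, forall u v, h u v ->
  #|X| <= #|nb h X u| + #|nb h X v| + g}.
Hypothesis no_clique : forall S : {set T}, S \subset X ->
  {in S &, forall u v, ~~ h u v} -> #|S| < k.
Hypotheses (le_gb : g.+2 <= b) (le_ba : b <= a) (large : k.*2 <= #|X|.+1).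
Implicit Types (S : {set T}) (u v w z : T).

Lemma nb_sub S v : nb h S v \subset S.
Proof. by apply/subsetP => z; rewrite inE => /andP[]. Qed.

Lemma nb_lt_clique v : #|nb h X v| < k.
Proof.
apply: no_clique (nb_sub X v) _ => u w; rewrite !inE => /andP[_ vu] /andP[_ vw].
by apply: contraTN vw => uw; apply: h_tri vu uw.
Qed.

Lemma nb_gt u v : u \in X -> v \in X -> h u v -> #|X| < #|nb h X u| + k + g.
Proof.
by move=> Xu Xv uv; have := dense Xu Xv uv; have := nb_lt_clique v; lia.
Qed.

(** Double counting the pairs of a listed vertex and an h-neighbour of it in X. *)
Lemma leq_sum_nb (s : seq T) m :
  {in X, forall z, \sum_(v <- s) h v z <= m} ->
  \sum_(v <- s) #|nb h X v| <= m * #|X|.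
Proof.
move=> le_m; under eq_bigr => v _.
  rewrite -sum1_card (eq_bigl (fun z => (z \in X) && h v z)); last first.
    by move=> z; rewrite inE.
  rewrite big_mkcondr /=; under eq_bigr => z _ do
    rewrite -[if _ then _ else _]/(nat_of_bool (h v z)).
  over.
by rewrite exchange_big /= mulnC -sum_nat_const; apply: leq_sum.
Qed.

Lemma leq_card_nb3 u v w :
  [disjoint nb h X u & nb h X v] -> [disjoint nb h X u & nb h X w] ->
  [disjoint nb h X v & nb h X w] ->
  #|nb h X u| + #|nb h X v| + #|nb h X w| <= #|X|.
Proof.
move=> uv uw vw.
have /eqP <- : #|nb h X u :|: nb h X v| == #|nb h X u| + #|nb h X v|.
  by rewrite (leq_card_setU _ _).2.
have /eqP <- : #|nb h X u :|: nb h X v :|: nb h X w| ==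
    #|nb h X u :|: nb h X v| + #|nb h X w|.
  rewrite (leq_card_setU _ _).2 -setI_eq0 setIUl setU_eq0 !setI_eq0.
  by rewrite uw vw.
by apply: subset_leq_card; rewrite !subUset !nb_sub.
Qed.

Variables (x y : T).
Hypotheses (Xx : x \in X) (Xy : y \in X) (xy : h x y).

Let Nx := nb h X x.
Let Ny := nb h X y.
Let R := [set u in X :\: Nx :\: Ny | nb h Ny u != set0].
Let Z := [set u in R | nb h Nx u != set0].
Let Ux := [set v in Nx | nb h Z v != set0].
Let Uy := [set v in Ny | nb h Z v != set0].

(** The vertices of X outside Nx and R form a clique: two of them that are
    h-related and lie outside Ny would have, together with y, pairwise disjoint
    neighbourhoods, too large to fit into X. *)
Lemma card_Nx_R : k <= #|Nx| + #|R|.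
Proof.
pose S := X :\: (Nx :|: R).
have SX : S \subset X by apply: subsetDl.
have S_indep : {in S &, forall u v, ~~ h u v}.
  have far u : u \in S -> u \notin Ny -> [disjoint nb h X u & Ny].
    move=> Su nyu; have Xu := subsetP SX u Su.
    have -> : [disjoint nb h X u & Ny] = (nb h Ny u == set0).
      rewrite -setI_eq0; congr (_ == _); apply/setP => z; rewrite !inE.
      by case: (z \in X); rewrite ?andbF //= andbC.
    apply: contraTT Su => uNy; rewrite in_setD in_setU Xu andbT negbK.
    by case: (boolP (u \in Nx)) => //= nx; rewrite inE uNy !in_setD nyu nx Xu.
  have toNy u v : u \in S -> u \notin Ny -> v \in Ny -> ~~ h u v.
    move=> Su nyu yv; apply/negP => uv.
    have := disjointFl (far u Su nyu) yv; rewrite inE uv andbT.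
    by move: yv; rewrite inE => /andP[->].
  move=> u v Su Sv; have [Xu Xv] := (subsetP SX u Su, subsetP SX v Sv).
  case: (boolP (u \in Ny)) => yu; case: (boolP (v \in Ny)) => yv.
  - move: yu yv; rewrite !inE => /andP[_ yu] /andP[_ yv].
    by apply: contraTN yv => uv; apply: h_tri yu uv.
  - by rewrite h_sym toNy.
  - exact: toNy.
  - apply/negP => uv; have := dense Xu Xv uv.
    have := leq_card_nb3 (nb_disjoint h_tri X uv) (far u Su yu) (far v Sv yv).
    have := nb_gt Xy Xx; rewrite h_sym => /(_ xy).
    rewrite -/Ny; move: large le_gb le_ba; rewrite /k.
    move: #|X| #|Ny| #|nb h X u| #|nb h X v| => n dy du dv; clear; lia.
have := no_clique SX S_indep; have := leq_card_setU Nx R => -[leU _].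
have := cardsD X (Nx :|: R); rewrite -/S.
have : #|X :&: (Nx :|: R)| <= #|Nx :|: R| by apply: subset_leq_card (subsetIr _ _).
have := subset_leq_card (subsetIl X (Nx :|: R)).
lia.
Qed.

Lemma ZP u : u \in Z -> [/\ u \in X, u \notin Nx, u \notin Ny,
  exists2 p, p \in Nx & h u p & exists2 c, c \in Ny & h u c].
Proof.
rewrite inE => /andP[+ /set0Pn[p]]; rewrite inE => /andP[+ /set0Pn[c]].
rewrite [c \in _]inE [p \in _]inE => uR /andP[cy uc] /andP[px up].
move: uR; rewrite !in_setD => /and3P[ny nx Xu].
by split=> //; [exists p | exists c].
Qed.

Lemma UxP v : v \in Ux -> v \in Nx /\ exists2 u, u \in Z & h v u.
Proof.
rewrite inE => /andP[vx /set0Pn[u]]; rewrite [u \in _]inE => /andP[Zu vu].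
by split=> //; exists u.
Qed.

Lemma UyP v : v \in Uy -> v \in Ny /\ exists2 u, u \in Z & h v u.
Proof.
rewrite inE => /andP[vy /set0Pn[u]]; rewrite [u \in _]inE => /andP[Zu vu].
by split=> //; exists u.
Qed.

(** With v, u and w, u' related, and c, p witnessing that u and u' belong to Z,
    the pairs x p, y c, v u, w u' are four h-pairs, so the eight degrees add up
    to at least 4(n - g).  But no vertex can be h-related to one vertex from each
    pair without creating a triangle, so the sum is at most 3n < 4(n - g). *)
Lemma Ux_Uy v w : v \in Ux -> w \in Uy -> ~~ h v w.
Proof.
move=> /UxP[vx [u /ZP[Xu _ _ _ [c cy uc]] vu]].
move=> /UyP[wy [u' /ZP[Xu' _ _ [p px u'p] _] wu']]; apply/negP => vw.
move: vx wy cy px; rewrite !inE.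
move=> /andP[Xv xv] /andP[Xw yw] /andP[Xc yc] /andP[Xp xp].
have sum8 : {in X, forall z, \sum_(i <- [:: x; p; y; c; v; u; w; u']) h i z <= 3}.
  move=> z _; rewrite !big_cons big_nil.
  have no i j : h i j -> ~~ (h i z && h j z).
    by move=> ij; apply/negP => /andP[iz jz]; move: (h_tri ij jz); rewrite iz.
  move: (no _ _ xy) (no _ _ xv) (no _ _ xp) (no _ _ yw) (no _ _ yc) (no _ _ vw).
  move: (no _ _ vu) (no _ _ wu') (no _ _ uc) (no _ _ u'p).
  case: (h x z); case: (h p z); case: (h y z); case: (h c z); case: (h v z);
    by case: (h u z); case: (h w z); case: (h u' z).
have := leq_sum_nb sum8; rewrite !big_cons big_nil.
have := dense Xx Xp xp; have := dense Xy Xc yc; have := dense Xv Xu vu.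
have := dense Xw Xu' wu'; move: large le_gb le_ba; rewrite /k.
pose d z := #|nb h X z|; rewrite -!/(d _).
move: #|X| (d x) (d p) (d y) (d c) (d v) (d u) (d w) (d u').
clear; lia.
Qed.

Lemma card_Ux_Uy : #|Ux| + #|Uy| < k.
Proof.
have sx : Ux \subset Nx by apply/subsetP => v; rewrite inE => /andP[].
have sy : Uy \subset Ny by apply/subsetP => v; rewrite inE => /andP[].
have dxy : [disjoint Ux & Uy].
  exact: disjointWl sx (disjointWr sy (nb_disjoint h_tri X xy)).
have /eqP <- : #|Ux :|: Uy| == #|Ux| + #|Uy| by rewrite (leq_card_setU _ _).2.
have in_nb z u v : u \in nb h X z -> v \in nb h X z -> ~~ h u v.
  rewrite !inE => /andP[_ zu] /andP[_ zv].
  by apply: contraTN zv => uv; apply: h_tri zu uv.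
apply: no_clique.
  by rewrite subUset (subset_trans sx) ?(subset_trans sy) ?nb_sub.
move=> u v /setUP[] Uu /setUP[] Uv.
- by apply: (in_nb x); apply: (subsetP sx).
- exact: Ux_Uy.
- by rewrite h_sym Ux_Uy.
- by apply: (in_nb y); apply: (subsetP sy).
Qed.

(** If u in Z has the h-neighbour c in Ny, then c has no h-neighbour in Ny, and
    the neighbourhoods of u and c cover X up to g vertices, so that u alone covers
    Ny up to g vertices. *)
Lemma card_Uy u : u \in Z -> #|Ny| <= #|Uy| + g.
Proof.
move=> Zu; have [Xu _ _ _ [c cy uc]] := ZP Zu.
have [Xc yc] : c \in X /\ h y c by move: cy; rewrite inE => /andP[].
have sub : Ny \subset Uy :|: (X :\: (nb h X u :|: nb h X c)).
  apply/subsetP => z yz; rewrite in_setU in_setD in_setU.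
  have [Xz hyz] : z \in X /\ h y z by move: yz; rewrite inE => /andP[].
  rewrite ![z \in nb h X _]inE Xz /= andbT; case: (boolP (h u z)) => uz /=.
    by rewrite orbF inE yz; apply/set0Pn; exists u; rewrite inE Zu h_sym.
  by rewrite [h c z](negbTE _) ?orbT //; apply: contraTN hyz; apply: h_tri yc.
apply: leq_trans (subset_leq_card sub) _.
apply: leq_trans (leq_card_setU _ _) _; rewrite leq_add2l.
have := dense Xu Xc uc.
have /eqP <- : #|nb h X u :|: nb h X c| == #|nb h X u| + #|nb h X c|.
  by rewrite (leq_card_setU _ _).2 nb_disjoint.
by rewrite -leq_subLR cardsD (setIidPr _) // subUset !nb_sub.
Qed.

Lemma biclique_of_edge : has_biclique (adjacent h) X a b.
Proof.
have NxX : Nx \subset X := nb_sub X x.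
have NyX : Ny \subset X := nb_sub X y.
have dN : [disjoint Nx & Ny] := nb_disjoint h_tri X xy.
have UxN : Ux \subset Nx by apply/subsetP => v /UxP[].
have UyN : Uy \subset Ny by apply/subsetP => v /UyP[].
have sR : R \subset X :\: Nx :\: Ny by apply/subsetP => u; rewrite inE => /andP[].
have cNx : #|Nx| < k := nb_lt_clique x.
have cUU := card_Ux_Uy.
have cXN : #|X| <= #|Nx| + #|Ny| + g := dense Xx Xy xy.
have cNy : #|Ny| < k := nb_lt_clique y.
have cDx : #|Nx :\: Ux| + #|Ux| = #|Nx|.
  by rewrite addnC -{1}(setIidPr UxN) cardsID.
have cDy : #|Ny :\: Uy| + #|Uy| = #|Ny|.
  by rewrite addnC -{1}(setIidPr UyN) cardsID.
(* The side of size a is Nx minus B, completed by E to the right size. *)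
have [E sE cE] : exists2 E : {set T}, E \subset R & #|E| = k - #|Nx|.
  by apply: subset_of_card; rewrite leq_subLR card_Nx_R.
(* B meets Ux as little as possible; each vertex of the intersection needs its
   own detour vertex in Ny minus Uy. *)
have [B sB [cB cBU]] : exists2 B : {set T}, B \subset Nx &
    #|B| = b /\ #|B :&: Ux| <= #|Ny :\: Uy|.
  have [le_b|lt_b] := leqP b #|Nx :\: Ux|.
    have [B sB cB] := subset_of_card le_b; exists B.
      exact: subset_trans sB (subsetDl _ _).
    split=> //; suff -> : B :&: Ux = set0 by rewrite cards0.
    apply/setP => z; rewrite in_setI in_set0; apply/negP => /andP[Bz].
    by have := subsetP sB z Bz; rewrite in_setD => /andP[/negbTE->].
  have [|S sS cS] := @subset_of_card _ Ux (b - #|Nx :\: Ux|).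
    move: le_gb le_ba large cXN cNy cDx; rewrite /k.
    move: #|X| #|Nx| #|Ny| #|Ux| #|Nx :\: Ux| => n dx dy ux dux.
    clear; lia.
  exists (Nx :\: Ux :|: S).
    by rewrite subUset subsetDl (subset_trans sS).
  have -> : (Nx :\: Ux :|: S) :&: Ux = S.
    by rewrite setIUl (disjoint_setI0 (disjointDl Nx (subxx _))) set0U; apply/setIidPl.
  have dS : [disjoint Nx :\: Ux & S].
    exact: disjointDl.
  have /eqP -> : #|Nx :\: Ux :|: S| == #|Nx :\: Ux| + #|S|.
    by rewrite (leq_card_setU _ _).2.
  rewrite cS; move: lt_b le_gb le_ba large cXN cUU cDx cDy; rewrite /k.
  move: #|X| #|Nx| #|Ny| #|Ux| #|Nx :\: Ux| #|Uy| #|Ny :\: Uy|.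
  clear; lia.
have [s [sS s_inj]] := inj_into cBU.
have [t [tS t_inj]] : exists t : T -> T,
    {in E :&: Z, forall i, t i \in Uy} /\ {in E :&: Z &, injective t}.
  apply: inj_into; case: (set_0Vmem (E :&: Z)) => [->|[u]]; first by rewrite cards0.
  rewrite inE => /andP[_ Zu]; have cUy := card_Uy Zu.
  apply: leq_trans (subset_leq_card (subsetIl _ _)) _; rewrite cE.
  move: cUy le_gb le_ba large cXN; rewrite /k.
  move: #|X| #|Nx| #|Ny| #|Uy|; clear; lia.
have RP u : u \in R -> [/\ u \in X, u \notin Nx & u \notin Ny].
  by move=> /(subsetP sR); rewrite !in_setD => /and3P[].
have ZR u : u \in Z -> u \in R by rewrite inE => /andP[].
have EP u : u \in E -> [/\ u \in X, u \notin Nx & u \notin Ny].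
  by move=> /(subsetP sE)/RP.
have in_nb z u v : u \in nb h X z -> v \in nb h X z -> ~~ h u v.
  rewrite !inE => /andP[_ zu] /andP[_ zv].
  by apply: contraTN zv => uv; apply: h_tri zu uv.
pose A := Nx :\: B :|: E.
have dxE : [disjoint Nx & E].
  rewrite disjoint_sym -setI_eq0; apply/eqP/setP => z; rewrite in_setI in_set0.
  by apply/negP => /andP[/EP[_ /negbTE->]].
have cA : #|A| = a.
  have /eqP -> : #|A| == #|Nx :\: B| + #|E|.
    by rewrite (leq_card_setU _ _).2 (disjointWl _ dxE) // subsetDl.
  have := cardsD Nx B; rewrite (setIidPr sB) cE cB => ->.
  have := subset_leq_card sB; rewrite cB; move: cNx; rewrite /k.
  by move: #|Nx|; clear; lia.
have AP i : i \in A -> i \in X /\ i \notin Ny.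
  case/setUP => [/setDP[xi _]|/EP[? _ ?]//].
  by rewrite (subsetP NxX) // (disjointFr dN xi).
have AZ i : i \in A :&: Z -> i \in E :&: Z.
  rewrite 2!in_setI => /andP[/setUP[/setDP[xi _] /ZR/RP[_]|-> ->//]].
  by rewrite xi.
have BP j : j \in B -> j \in X /\ j \notin Ny.
  move=> /(subsetP sB) xj; rewrite (subsetP NxX) //.
  by rewrite (disjointFr dN xj).
have dAB : [disjoint A & B].
  rewrite -setI_eq0 setIUl (disjoint_setI0 (disjointDl Nx (subxx B))) set0U setI_eq0.
  by rewrite disjoint_sym (disjointWl sB dxE).
exists A, B, (fun i j =>
    (i, if (i \in Z) && (j \in Ux) then [:: s j; t i; j] else [:: j])).
split=> //; apply: (@linkage_detour _ _ _ _ _ _ _ (Ny :\: Uy) Uy) => //.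
- by apply/subsetP => z /setUP[/AP[]|/BP[]].
- by rewrite subUset (subset_trans (subsetDl _ _) NyX) (subset_trans UyN NyX).
- exact: disjointDl.
- rewrite disjoint_sym -setI_eq0; apply/eqP/setP => z; rewrite in_setI in_set0.
  apply/negP => /andP[zy zAB]; have yz : z \in Ny.
    by case/setUP: zy => [/setDP[]|/(subsetP UyN)].
  by case/setUP: zAB => [/AP[_]|/BP[_]]; rewrite yz.
- by move=> i /AZ; apply: tS.
- by move=> i j /AZ Ei /AZ Ej; apply: t_inj.
move=> i j Ai Bj; rewrite /adjacent.
have [Xi nyi] := AP i Ai; have xj := subsetP sB j Bj.
have neq u v (S : {set T}) : u \notin S -> v \in S -> u != v.
  by move=> nSu Sv; apply: contraNneq nSu => ->.
case: ifP => [/andP[Zi Uj]|].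
  have /setDP[ysj nUsj] : s j \in Ny :\: Uy by apply: sS; rewrite inE Bj.
  have Uti : t i \in Uy by apply/tS/AZ; rewrite inE Ai.
  have yti := subsetP UyN _ Uti.
  split.
  - rewrite (neq _ _ _ nyi ysj) /=; apply: contra nUsj => isj.
    by rewrite inE ysj; apply/set0Pn; exists i; rewrite inE Zi h_sym.
  - by rewrite (neq _ _ _ nUsj Uti) (in_nb y).
  - rewrite h_sym Ux_Uy // andbT eq_sym; apply: neq yti.
    by have [] := BP j Bj.
move=> /negbT nZU; rewrite (neq _ _ B) ?(disjointFr dAB Ai) //=.
apply: contra nZU => ij; case/setUP: Ai => [/setDP[xi _]|Ei].
  by have := in_nb x i j xi xj; rewrite ij.
have Zi : i \in Z.
  by rewrite inE (subsetP sE) //; apply/set0Pn; exists j; rewrite inE xj.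
by rewrite Zi inE xj; apply/set0Pn; exists i; rewrite inE Zi h_sym.
Qed.

End Dense.

(** * Induction on the vertex set *)

Section Induction.

Variables (T : finType) (h : rel T).
Hypotheses (h_sym : symmetric h) (h_irr : irreflexive h).
Hypothesis h_tri : forall u v w, h u v -> h v w -> ~~ h u w.
Implicit Types (X S : {set T}) (f : {ffun T -> T}).

Definition deficient X k : Prop :=
  forall f, matching h X f -> k.*2 <= #|X| + #|unmatched X f|.

Lemma card_unmatched_sub X X' f :
  X' \subset X -> matching h X' f ->
  #|unmatched X f| = #|unmatched X' f| + #|X :\: X'|.
Proof.
move=> sX fM; rewrite -(cardsID X' (unmatched X f)); congr (_ + _); apply: eq_card => z.
  rewrite !inE; case X'z: (z \in X'); rewrite ?andbF //= andbT.
  by rewrite (subsetP sX).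
rewrite !inE; case X'z: (z \in X') => //=; case Xz: (z \in X) => //=.
have /matchingP[_ fX] := fM; apply/negPn/negP => /fX[].
by rewrite X'z.
Qed.

Lemma matching_fix X f z : matching h X f -> z \notin X -> f z = z.
Proof.
by move=> /matchingP[_ fX] nXz; apply/eqP/negPn/negP => /fX[Xz _]; rewrite Xz in nXz.
Qed.

Lemma matching1 X : matching h X [ffun z => z].
Proof. by apply/matchingP; split=> [z|z]; rewrite !ffunE ?eqxx. Qed.

(** A matching of the smaller set is one of X that misses x as well. *)
Lemma deficient_D1 X x k : x \in X -> deficient X k.+1 -> deficient (X :\ x) k.
Proof.
move=> Xx defX f fM; have sX := subD1set X x.
have := defX f (matching_sub sX fM); rewrite (card_unmatched_sub sX fM).
have := cardsID (X :\ x) X; rewrite (setIidPr sX).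
have -> : X :\: (X :\ x) = [set x].
  by rewrite setDDr setDv set0U; apply/setIidPr; rewrite sub1set.
rewrite cards1; lia.
Qed.

(** A matching of the smaller set extends to X by the edge between x and y. *)
Lemma deficient_D2 X x y k : x \in X -> y \in X -> h x y ->
  deficient X k.+1 -> deficient (X :\: [set x; y]) k.
Proof.
move=> Xx Xy xy defX f fM; have neq_xy := h_neq h_irr xy.
have sX : X :\: [set x; y] \subset X by apply: subsetDl.
have fx : f x = x by apply: matching_fix fM _; rewrite !inE eqxx.
have fy : f y = y by apply: matching_fix fM _; rewrite !inE eqxx orbT.
have := defX _ (matching_add h_sym (matching_sub sX fM) Xx Xy xy fx fy).
have := card_unmatched_add Xx Xy neq_xy fx fy.
rewrite (card_unmatched_sub sX fM).
have := cardsID (X :\: [set x; y]) X; rewrite (setIidPr sX).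
have -> : X :\: (X :\: [set x; y]) = [set x; y].
  by rewrite setDDr setDv set0U; apply/setIidPr; rewrite subUset !sub1set Xx.
rewrite cards2 neq_xy; lia.
Qed.

(** Every vertex is missed by some maximum matching.  If a maximum matching
    missed two vertices s and t, let K be the set of vertices not joint with s.
    By [joint_cover] no vertex of K is h-related to one outside K; K contains s
    but not t.  An h-pair inside K and one outside K, each with neighbourhoods
    covering X up to g vertices, then give n <= 2g, while n >= k > 2g. *)
Lemma large_of_critical X k g :
  deficient X k -> (forall r, r \in X -> ~ deficient (X :\ r) k) ->
  g.*2 < k -> {in X, forall u, exists2 v, v \in X & h u v} ->
  {in X &, forall u v, h u v -> #|X| <= #|nb h X u| + #|nb h X v| + g} ->
  k.*2 <= #|X|.+1.
Proof.
move=> defX crit lt_gk nbX dense.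
have [f0 f0M f0min] : exists2 f0, matching h X f0 &
    forall f, matching h X f -> #|unmatched X f0| <= #|unmatched X f|.
  have [f0 f0M f0min] := arg_minnP (fun f => #|unmatched X f|) (matching1 X).
  by exists f0.
set d := #|unmatched X f0| in f0min.
have fixing r : r \in X ->
    exists f, [/\ matching h X f, #|unmatched X f| = d & f r = r].
  move=> Xr; have sX := subD1set X r.
  have : ~~ [forall f : {ffun T -> T}, matching h (X :\ r) f ==>
               (k.*2 <= #|X :\ r| + #|unmatched (X :\ r) f|)].
    by apply/negP => /forallP cr; apply: (crit r Xr) => f; apply/implyP.
  rewrite negb_forall => /existsP[f]; rewrite negb_imply -ltnNge => /andP[fM lt_k].
  have fMX := matching_sub sX fM; exists f; split=> //.
    have := f0min f fMX; have := card_leader fMX; have := card_leader f0M.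
    have := card_unmatched_sub sX fM; have := cardsD1 r X.
    have -> : X :\: (X :\ r) = [set r].
      by rewrite setDDr setDv set0U; apply/setIidPr; rewrite sub1set.
    (* Parity excludes that f misses exactly d + 1 vertices. *)
    rewrite Xr cards1 -/d; have := defX f0 f0M; rewrite -/d; move: lt_k.
    move: #|unmatched _ _| #|unmatched _ _| #|X :\ r| #|X| #|_ :&: _| #|_ :&: _|.
    clear; lia.
  by apply: matching_fix fM _; rewrite setD11.
have := defX f0 f0M; rewrite -/d; have [|lt_d le_k] := leqP d 1; first by lia.
have [s [t [ds dt st]]] : exists s t,
    [/\ s \in unmatched X f0, t \in unmatched X f0 & s != t].
  by have /card_gt1P[s [t [? ? ?]]] := lt_d; exists s, t.
have [Xs /eqP fs] : s \in X /\ f0 s == s by apply/andP; rewrite inE in ds.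
have [Xt /eqP ft] : t \in X /\ f0 t == t by apply/andP; rewrite inE in dt.
have jst : joint h X d s t by apply/jointP; exists f0.
pose K := [set r in X | ~~ joint h X d s r].
have cover r u v Xr := joint_cover h_sym f0min (fixing r Xr) Xr (s := u) (t := v).
have [p Xp hsp] := nbX s Xs; have [q Xq htq] := nbX t Xt.
have nj u v : u \in X -> v \in X -> h u v -> joint h X d u v = false.
  by move=> Xu Xv uv; apply/negbTE/(joint_h h_sym f0min).
have sK : nb h X s :|: nb h X p \subset K.
  apply/subsetP => z; rewrite !inE -andb_orr => /andP[Xz szp]; rewrite Xz /=.
  apply/negP => jsz; case/orP: szp => [sz|pz]; first by rewrite nj in jsz.
  by have := cover p s z Xp Xs Xz jsz; rewrite nj // joint_sym nj.
have sKC : nb h X t :|: nb h X q \subset X :\: K.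
  apply/subsetP => z; rewrite !inE -andb_orr => /andP[Xz tzq]; rewrite Xz /= negbK.
  have jsq : joint h X d s q.
    by have := cover q s t Xq Xs Xt jst; rewrite (nj t q) // orbF.
  case/orP: tzq => [tz|qz].
    by have := cover z s t Xz Xs Xt jst; rewrite (nj t z) // orbF.
  by have := cover z s q Xz Xs Xq jsq; rewrite (nj q z) // orbF.
have cU u v : u \in X -> v \in X -> h u v ->
    #|X| <= #|nb h X u :|: nb h X v| + g.
  move=> Xu Xv uv; suff /eqP -> : #|nb h X u :|: nb h X v| == #|nb h X u| + #|nb h X v|.
    exact: dense.
  by rewrite (leq_card_setU _ _).2 nb_disjoint.
have := subset_leq_card sK; have := subset_leq_card sKC.
have := cU s p Xs Xp hsp; have := cU t q Xt Xq htq.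
have := cardsID K X; rewrite (setIidPr _); last first.
  by apply/subsetP => z; rewrite inE => /andP[].
have := defX _ (matching1 X).
have : #|unmatched X [ffun z => z]| <= #|X|.
  by apply: subset_leq_card; apply/subsetP => z; rewrite inE => /andP[].
move: lt_gk.
move: #|_ :|: _| #|_ :|: _| #|unmatched _ _| #|X :\: K| #|X| #|K|.
clear; lia.
Qed.

(** Once all reductions fail, the assumptions of the dense case hold with
    g = b - 2. *)
Lemma biclique_step X a b :
  (forall X' a' b', #|X'| < #|X| -> deficient X' (a' + b') ->
     has_biclique (adjacent h) X' a' b') ->
  b <= a -> deficient X (a + b) -> has_biclique (adjacent h) X a b.
Proof.
move=> IH; case: a => [|a].
  rewrite leqn0 => /eqP-> _; rewrite -(@cards0 T).
  apply: has_biclique_direct; first by rewrite setU0 sub0set.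
  - by rewrite -setI_eq0 setI0.
  - exact: adjacent_irr.
  - by move=> i j; rewrite inE.
move=> le_ba defX.
case: (boolP [exists x in X, [forall u in X, ~~ h x u]]) => [|no_univ].
  case/existsP => x /andP[Xx /forall_inP hx]; apply: (add_universal Xx hx).
  apply: IH (deficient_D1 Xx defX).
  by rewrite (cardsD1 x X) Xx.
have nbX : {in X, forall u, exists2 v, v \in X & h u v}.
  move=> u Xu; move: no_univ; rewrite negb_exists => /forallP/(_ u).
  rewrite Xu negb_forall => /existsP[v]; rewrite negb_imply negbK => /andP[Xv uv].
  by exists v.
pose C u v := X :\: nb h X u :\: nb h X v.
case: (boolP [exists x in X, [exists y in X, h x y && (b <= #|C x y|.+1)]]) => [|no_pair].
  case/existsP => x /andP[Xx] /existsP[y] /and3P[Xy xy le_b].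
  apply: (add_far_pair h_sym h_irr h_tri Xx Xy xy le_b).
  apply: IH (deficient_D2 Xx Xy xy defX).
  apply: proper_card; apply/properP; split; first exact: subsetDl.
  by exists x; rewrite // !inE eqxx.
have few_common : {in X &, forall u v, h u v -> #|C u v|.+1 < b}.
  move=> u v Xu Xv uv; rewrite ltnNge; apply: contra no_pair => le_b.
  by apply/existsP; exists u; rewrite Xu; apply/existsP; exists v; rewrite Xv uv.
case: (boolP [exists S : {set T}, [&& S \subset X, a.+1 + b <= #|S| &
                [forall u in S, forall v in S, ~~ h u v]]]) => [|no_clique].
  case/existsP => S /and3P[SX le_S /forall_inP indep].
  have [A sA cA] : exists2 A : {set T}, A \subset S & #|A| = a.+1.
    by apply: subset_of_card; apply: leq_trans le_S; apply: leq_addr.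
  have [B sB cB] : exists2 B : {set T}, B \subset S :\: A & #|B| = b.
    by apply: subset_of_card; rewrite cardsD (setIidPr sA) cA leq_subRL // -cA
      subset_leq_card.
  have dAB : [disjoint A & B] by rewrite disjoint_sym (disjointWl sB) // disjointDl.
  have sBS := subset_trans sB (subsetDl _ _).
  rewrite -cA -cB; apply: has_biclique_direct => //.
  - by rewrite subUset (subset_trans sA) ?(subset_trans sBS).
  - exact: adjacent_irr.
  - move=> i j Ai Bj; rewrite /adjacent; apply/andP; split.
      by apply: contraTneq Bj => <-; rewrite (disjointFr dAB).
    by have /forall_inP := indep i (subsetP sA i Ai); apply; apply: (subsetP sBS).
case: (boolP [exists r in X, [forall f : {ffun T -> T}, matching h (X :\ r) f ==>
     ((a.+1 + b).*2 <= #|X :\ r| + #|unmatched (X :\ r) f|)]]) => [|crit].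
  case/existsP => r /andP[Xr /forallP defXr].
  have sX := subD1set X r.
  have [A [B [P [[sAB ? path_P ?] ? ?]]]] : has_biclique (adjacent h) (X :\ r) a.+1 b.
    apply: IH; first by rewrite (cardsD1 r X) Xr.
    by move=> f fM; apply: (implyP (defXr f)).
  exists A, B, P; split=> //; split=> //; first exact: subset_trans sX.
  move=> i j Ai Bj; move: (path_P i j Ai Bj); case: (P i j) => z p [? ? ? sp].
  by split=> // w /sp; apply: subsetP.
have [x Xx] : exists x, x \in X.
  apply/set0Pn; apply/negP => /eqP X0; move: defX; rewrite X0 => /(_ _ (matching1 _)).
  rewrite (_ : unmatched _ _ = set0) ?cards0 //.
  by apply/setP => z; rewrite !inE.
have [y Xy xy] := nbX x Xx.
have b_gt1 : 1 < b := leq_ltn_trans (ltn0Sn _) (few_common x y Xx Xy xy).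
have dense : {in X &, forall u v, h u v -> #|X| <= #|nb h X u| + #|nb h X v| + b.-2}.
  move=> u v Xu Xv uv; have := few_common u v Xu Xv uv; rewrite /C setDDl => lt_b.
  have : #|nb h X u :|: nb h X v| <= #|nb h X u| + #|nb h X v| by rewrite leq_card_setU.
  have := cardsID (nb h X u :|: nb h X v) X; move: lt_b.
  have := subset_leq_card (subsetIr X (nb h X u :|: nb h X v)).
  move: #|_ :&: _| #|_ :|: _| #|_ :\: _| #|X| #|nb h X u| #|nb h X v|.
  clear; lia.
apply: (biclique_of_edge h_sym h_tri dense _ _ le_ba _ Xx Xy xy).
- move=> S SX indep; rewrite ltnNge; apply: contra no_clique => le_S.
  apply/existsP; exists S; rewrite SX le_S /=.
  by apply/forall_inP => u Su; apply/forall_inP => v Sv; apply: indep.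
- by move: b_gt1; case: (b) => [|[]].
- apply: (large_of_critical defX _ _ nbX dense); last first.
    by move: le_ba b_gt1; clear; lia.
  move=> r Xr defXr; case/negP: crit; apply/existsP; exists r; rewrite Xr.
  by apply/forallP => f; apply/implyP; apply: defXr.
Qed.

Theorem biclique_of_deficient X a b :
  deficient X (a + b) -> has_biclique (adjacent h) X a b.
Proof.
elim: {X}_.+1 {-2}X (ltnSn #|X|) a b => // n IHn X lt_n a b defX.
have IH X' a' b' : #|X'| < #|X| -> deficient X' (a' + b') ->
    has_biclique (adjacent h) X' a' b'.
  by move=> ltX; apply: IHn; apply: leq_trans ltX _.
have [le_ba|/ltnW le_ab] := leqP b a; first exact: biclique_step.
by apply: has_biclique_sym; apply: biclique_step; rewrite // addnC.
Qed.

End Induction.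

(** * From non-adjacency back to multigraphs *)

Section Graphs.

Variable G : mgraph.
Implicit Types (u v w x : G) (p : seq G).

Lemma adj_sym : symmetric (@adj G).
Proof. by move=> u v; apply: eq_existsb => e; rewrite setUC. Qed.

Lemma adj_irr : irreflexive (@adj G).
Proof.
move=> u; apply/existsP => -[e /eqP uu].
by have := ends_card e; rewrite uu setUid cards1.
Qed.

(** A chosen edge between consecutive vertices; the list is cut short where there
    is none, which does not happen along a path of the graph. *)
Fixpoint steps x p : seq (edge G * G) :=
  if p is y :: p' then
    if [pick e | ends e == [set x; y]] is Some e then (e, y) :: steps y p' else [::]
  else [::].

Lemma stepsP x p : path (@adj G) x p ->
  [/\ walk x (steps x p), [seq s.2 | s <- steps x p] = p
    & [seq ends e | e <- path_edges (steps x p)] = path_pairs x p].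
Proof.
elim: p x => //= y p IHp x /andP[/existsP[e0 e0P] /IHp[wp vp ep]].
case: pickP => [e exy|/(_ e0)]; last by rewrite e0P.
by rewrite /= exy wp vp ep (eqP exy).
Qed.

Lemma immersion_of_biclique (e : rel G) a b :
  subrel e (@adj G) -> has_biclique e [set: G] a b ->
  contains_immersion G (complete_bipartite a b).
Proof.
move=> sub_e [A [B [P [[_ dAB path_P edge_P] <- <-]]]].
pose f (s : 'I_#|A| + 'I_#|B|) :=
  match s with inl i => enum_val i | inr j => enum_val j end.
pose Q (ij : 'I_#|A| * 'I_#|B|) := P (enum_val ij.1) (enum_val ij.2).
have QP ij : [/\ path (@adj G) (Q ij).1 (Q ij).2, uniq ((Q ij).1 :: (Q ij).2)
    & [set (Q ij).1; last (Q ij).1 (Q ij).2] = [set f (inl ij.1); f (inr ij.2)]].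
  have := path_P _ _ (enum_valP ij.1) (enum_valP ij.2); rewrite -/(Q ij).
  by case: (Q ij) => x p [/(sub_path sub_e) ? ? ? _].
exists f, (fun ij => ((Q ij).1, steps (Q ij).1 (Q ij).2)); split.
- have nAB (i : 'I_#|A|) (j : 'I_#|B|) : enum_val i <> enum_val j.
    move=> ij; have := disjointFr dAB (enum_valP i).
    by rewrite ij (enum_valP j).
  move=> [i|j] [i'|j'] /=; do ?[by move/enum_val_inj->].
    by move/nAB.
  by move/esym/nAB.
- move=> ij; have [Qpath Quniq _] := QP ij; have [wQ vQ _] := stepsP Qpath.
  by rewrite /is_path /= wQ vQ.
- move=> ij; have [Qpath _ Qends] := QP ij; have [_ vQ _] := stepsP Qpath.
  by rewrite /path_ends /= vQ Qends imsetU1 imset_set1.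
- move=> ij ij' neq_ij; apply/pred0P => e0 /=; apply/negP => /andP[e1 e2].
  have [[Q1 _ _] [Q2 _ _]] := (QP ij, QP ij').
  have [[_ _ ep] [_ _ ep']] := (stepsP Q1, stepsP Q2).
  case/eqP: neq_ij; case: ij ij' e1 e2 {Q1 Q2} ep ep' => [i j] [i' j'] e1 e2 ep ep'.
  have [||/enum_val_inj-> /enum_val_inj->//] := edge_P (ends e0) _ _ _ _
    (enum_valP i) (enum_valP j) (enum_valP i') (enum_valP j').
    by rewrite -[path_pairs _ _]ep map_f.
  by rewrite -[path_pairs _ _]ep' map_f.
Qed.

Lemma colorable_of_reps (r : G -> G) (L : {set G}) :
  (forall v, r v \in L) -> (forall u v, adj u v -> r u != r v) -> colorable G #|L|.
Proof.
move=> rL r_proper; apply/existsP; exists [ffun v => enum_rank_in (rL v) (r v)].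
apply/forallP => u; apply/forallP => v; apply/implyP => /r_proper; rewrite !ffunE.
by apply: contraNneq => /(congr1 enum_val); rewrite !enum_rankK_in // => ->.
Qed.

Definition far u v := (u != v) && ~~ adj u v.

Lemma far_sym : symmetric far.
Proof. by move=> u v; rewrite /far eq_sym adj_sym. Qed.

Lemma far_irr : irreflexive far.
Proof. by move=> u; rewrite /far eqxx. Qed.

Lemma far_tri : independence_number G = 2 ->
  forall u v w, far u v -> far v w -> ~~ far u w.
Proof.
move=> alpha2 u v w /andP[uv nuv] /andP[vw nvw]; apply/negP => /andP[uw nuw].
have: #|[set u; v; w]| <= independence_number G.
  apply: leq_bigmax_cond; apply/forall_inP => x xS; apply/forall_inP => y.
  move: xS; rewrite !inE => /orP[/orP[]|] /eqP-> /orP[/orP[]|] /eqP->;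
    by rewrite ?adj_irr // adj_sym.
by rewrite alpha2 setUC cardsU1 cards2 !inE uv eq_sym negb_or uw eq_sym vw.
Qed.

(** The edges and unmatched vertices of a matching of the non-adjacency relation
    are the classes of a proper colouring. *)
Lemma deficient_chromatic : deficient far [set: G] (chromatic_number G).
Proof.
move=> f fM; rewrite -(card_leader fM) leq_double setTI.
have /matchingP[fK fX] := fM; pose r v := if v \in leader f then v else f v.
rewrite /chromatic_number; case: ex_minnP => m _; apply.
apply: (@colorable_of_reps r) => [v|u v uv].
  rewrite /r; case: ifPn => //; rewrite !inE fK -ltnNge; exact: ltnW.
have nf w : adj w (f w) = false.
  case: (eqVneq (f w) w) => [->|/fX[_]]; first exact: adj_irr.
  by case/andP => _ /negbTE.
apply/eqP => ruv; suff: u = v \/ v = f u.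
  by case=> vE; move: uv; rewrite ?vE ?nf // adj_irr.
move: ruv; rewrite /r; case: ifP => _; case: ifP => _ uv'; [left|right|right|left] => //.
- by rewrite uv' fK.
- exact: inv_inj fK _ _ uv'.
Qed.

End Graphs.

Theorem corollary4 (G : mgraph) (l : nat) :
  independence_number G = 2 ->
  1 <= l <= chromatic_number G - 1 ->
  contains_immersion G (complete_bipartite l (chromatic_number G - l)).
Proof.
move=> alpha2 /andP[_ le_l].
have le_lk : l <= chromatic_number G by apply: leq_trans le_l (leq_subr _ _).
apply: (@immersion_of_biclique _ (adjacent (@far G))) => [u v|].
  by rewrite /adjacent /far => /andP[->]; rewrite negbK.
apply: (biclique_of_deficient (@far_sym G) (@far_irr G) (far_tri alpha2)).
by rewrite subnKC //; apply: deficient_chromatic.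
Qed.
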